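(* There exists an absolute constant $C>0$ such that for every integer $k\ge 1$ and every finite undirected unweighted graph $G$ whose edge set can be covered by at most $k$ shortest paths (i.e., there are shortest paths $P_1,\dots,P_m$ of $G$, $m\le k$, with $E(G)=\bigcup_i E(P_i)$), the pathwidth of $G$ satisfies $\operatorname{pw}(G)\le C\cdot 3^k$.
   Context: A path decomposition of $G=(V,E)$ is a sequence $(X_1,\dots,X_q)$ of subsets of $V$ such that every edge has both endpoints in some $X_i$, and for every vertex $x$ the indices $i$ with $x\in X_i$ form a contiguous interval. Its width is $\max_i |X_i|-1$, and $\operatorname{pw}(G)$ is the minimum width of a path decomposition of $G$. A shortest path is a path between two vertices whose number of edges equals their distance in $G$. *)

(* Defs.v *)
From mathcomp Require Import all_boot all_order all_algebra.
From mathcomp Require Import boolp.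

Set Implicit Arguments.
Unset Strict Implicit.
Unset Printing Implicit Defensive.

Import Order.TTheory GRing.Theory Num.Theory.

(* A finite simple graph is a symmetric irreflexive relation [e] on a finType
   [V].  A path is encoded as its first vertex [x] and the sequence [p] of the
   following vertices, so [size p] is its number of edges; [p = [::]] is the
   one-vertex path. *)

Section Graph.
Variables (V : finType) (e : rel V).

Definition edge_set : {set {set V}} :=
  [set [set z.1; z.2] | z : V * V & e z.1 z.2].

Definition path_between (x y : V) (p : seq V) : bool :=
  [&& path e x p, uniq (x :: p) & last x p == y].

(* The least number of edges of a path from [x] to [y]; it takes the value
   [#|V|], which no path attains, when [y] is not reachable from [x]. *)
Definition dist (x y : V) : nat :=
  find (fun n => [exists p : n.-tuple V, path_between x y p]) (iota 0 #|V|).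

Definition shortest_path (P : V * seq V) : bool :=
  path_between P.1 (last P.1 P.2) P.2
  && (size P.2 == dist P.1 (last P.1 P.2)).

Definition path_edges (P : V * seq V) : {set {set V}} :=
  [set:: [seq [set z.1; z.2] | z <- zip (P.1 :: P.2) P.2]].

(* The index intervals are nonempty, so every vertex, isolated or not, lies in
   some bag. *)
Definition path_decomposition (X : seq {set V}) : Prop :=
  (forall x y, e x y -> exists2 B, B \in X & (x \in B) && (y \in B)) /\
  (forall x, exists i j, [/\ i <= j, j < size X &
     forall l, l < size X -> (x \in nth set0 X l) = (i <= l <= j)]).

(* Valued in [int]: the width is [-1] when all bags are empty. *)
Definition width (X : seq {set V}) : int :=
  ((\max_(B <- X) #|B|)%:Z - 1)%R.

Lemma pathwidth_subproof :
  exists n, `[< exists2 X, path_decomposition X & width X = (n%:Z - 1)%R >].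
Proof.
exists #|V|; apply/asboolP; exists [:: [set: V]].
  split=> [x y _|x]; first by exists [set: V]; rewrite ?inE.
  by exists 0, 0; split=> // -[|l] //= _; rewrite inE.
by rewrite /width big_seq1 cardsT.
Qed.

(* The minimum is taken over [n = width + 1], which is a natural number. *)
Definition pathwidth : int := ((ex_minn pathwidth_subproof)%:Z - 1)%R.

Lemma dist_le (x y : V) (p : seq V) : path_between x y p -> dist x y <= size p.
Proof.
move=> xpy; have ltp : size p < #|V|.
  have /and3P[_ /card_uniqP up _] := xpy.
  by have := max_card (mem (x :: p)); rewrite up.
rewrite leqNgt; apply/negP => /(before_find 0); rewrite nth_iota // add0n.
by move/existsP; apply; exists (in_tuple p).
Qed.

Lemma dist_attained (x y : V) (p : seq V) : path_between x y p ->
  exists2 q, path_between x y q & size q = dist x y.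
Proof.
move=> xpy; have ltp : size p < #|V|.
  have /and3P[_ /card_uniqP up _] := xpy.
  by have := max_card (mem (x :: p)); rewrite up.
have ltd := leq_ltn_trans (dist_le xpy) ltp.
have := ltd; rewrite /dist -[X in _ < X](size_iota 0) -has_find => /(nth_find 0).
rewrite nth_iota // add0n => /existsP[q xqy].
by exists q => //; rewrite size_tuple.
Qed.

Lemma pathwidth_attained :
  exists2 X, path_decomposition X & width X = pathwidth.
Proof. by rewrite /pathwidth; case: ex_minnP => n /asboolP. Qed.

Lemma pathwidth_le (X : seq {set V}) :
  path_decomposition X -> (pathwidth <= width X)%R.
Proof.
move=> pdX; rewrite /pathwidth; case: ex_minnP => n _ min_n.
by rewrite lerD2r lez_nat min_n //; apply/asboolP; exists X.
Qed.

End Graph.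

(* Main.v *)
Require Import Defs.
From mathcomp Require Import all_boot all_order all_algebra.
From mathcomp Require Import boolp zify.

(* The layers of a breadth-first search, taken two by two, form a path
   decomposition, so it suffices that every sphere has at most 3^k vertices.
   The edges of a geodesic from a to v can be coloured by the k paths, and
   each path, being shortest, can be made to appear with a single orientation.
   A minimal set of oriented paths carrying such a geodesic is one of 3^k
   partial sign functions.  Together with d(a, v) it determines v: if c is an
   oriented path of the set through a, then all the vertices so encoded are
   reached by first following c, leaving it at a common vertex z, and then
   avoiding c, and one concludes by induction on the set from z. *)

Set Implicit Arguments.
Unset Strict Implicit.
Unset Printing Implicit Defensive.

(** * Geodesics composed of segments of isometric paths *)

Section Geodesics.
Variables (V I : finType) (d : V -> V -> nat).
Variables (L : I -> {pred V}) (pos : I -> V -> nat).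
Hypothesis dxx : forall x, d x x = 0.
Hypothesis d_eq0 : forall x y, d x y = 0 -> x = y.
Hypothesis d_triangle : forall x y z, d x z <= d x y + d y z.
(** Subtraction being truncated, the sum is the absolute difference of the positions: each path sits
    isometrically on a line. *)
Hypothesis d_pos : forall c x y, x \in L c -> y \in L c ->
  d x y = (pos c x - pos c y) + (pos c y - pos c x).

Definition between x y z := d x z = d x y + d y z.

Lemma between_trans x w y z :
  between x y z -> between x w y -> between x w z /\ between w y z.
Proof.
rewrite /between => xyz xwy.
have := d_triangle x w z; have := d_triangle w y z; lia.
Qed.

Lemma between_transr x y w z :
  between x y z -> between y w z -> between x w z /\ between x y w.
Proof.
rewrite /between => xyz xwy.
have := d_triangle x w z; have := d_triangle x y w; lia.
Qed.

(** In an oriented path [(c, b)], positions increase when [b] is [true] and decrease otherwise. *)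
Definition seg (s : I * bool) x y :=
  [&& x \in L s.1, y \in L s.1
    & if s.2 then pos s.1 x <= pos s.1 y else pos s.1 y <= pos s.1 x].

Lemma seg_total c x y : x \in L c -> y \in L c -> exists b, seg (c, b) x y.
Proof.
move=> xc yc; exists (pos c x <= pos c y); rewrite /seg xc yc /=.
by case: leqP => // /ltnW.
Qed.

(** All three points lie on one line, and as [y != z] the point [x] can only be on the side of [y]
    away from [z]. *)
Lemma seg_prefix s x y z :
  x \in L s.1 -> y != z -> seg s y z -> between x y z -> seg s x z.
Proof.
rewrite /between /seg => xs yz /and3P[ys zs]; rewrite xs zs /=.
have : d y z <> 0 by move/d_eq0/eqP; apply/negP.
rewrite !(d_pos xs ys, d_pos xs zs, d_pos ys zs); case: s.2; lia.
Qed.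

Lemma seg_between s x y z :
  seg s x y -> seg s x z -> d x y <= d x z -> between x y z.
Proof.
rewrite /between /seg => /and3P[xs ys xy] /and3P[_ zs]; move: xy.
rewrite !(d_pos xs ys, d_pos xs zs, d_pos ys zs); case: s.2; lia.
Qed.

(* [between] makes the concatenated segments a geodesic of [d]. *)
Inductive geo (S : {set I * bool}) : V -> V -> Prop :=
| geo_nil x : geo S x x
| geo_cons s x y z : s \in S -> x != y -> seg s x y -> geo S y z ->
    between x y z -> geo S x z.

Lemma geo_seg (S : {set I * bool}) s x y z :
  s \in S -> seg s x y -> geo S y z -> between x y z -> geo S x z.
Proof.
move=> sS xy yz b; have [->//|nxy] := eqVneq x y.
exact: geo_cons sS nxy xy yz b.
Qed.

Lemma geo_trans S x y z : geo S x y -> geo S y z -> between x y z -> geo S x z.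
Proof.
move=> xy; elim: xy z => {x y} // s x w y sS _ xw _ IH xwy z yz xyz.
have [xwz wyz] := between_trans xyz xwy.
exact: geo_seg sS xw (IH _ yz wyz) xwz.
Qed.

Lemma geo_sub (S T : {set I * bool}) x y :
  S \subset T -> geo S x y -> geo T x y.
Proof.
move=> /subsetP ST; elim=> {x y} [x|s x w y sS nxw xw _ IH xwy].
  exact: geo_nil.
exact: geo_cons (ST _ sS) nxw xw IH xwy.
Qed.

Lemma geo_start S x y : geo S x y -> x = y \/ exists2 s, s \in S & x \in L s.1.
Proof.
case=> {x y} [x|s x y z sS _ /and3P[xs _ _] _ _]; [by left | right].
by exists s.
Qed.

(* Both orientations of [c] are removed at once, so that [c] can be reused after
   [z] with whichever orientation is convenient. *)
Lemma geo_first_on c S x y : geo S x y -> y \in L c ->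
  exists z, [/\ z \in L c, geo (S :\: [set s | s.1 == c]) x z & between x z y].
Proof.
move=> xy yc; elim: xy yc => {x y} [x|s x w y sS nxw xw _ IH xwy] yc.
  by exists x; split=> //; [apply: geo_nil | rewrite /between dxx].
have [sc|sc] := eqVneq s.1 c.
  exists x; split; [|exact: geo_nil|by rewrite /between dxx].
  by rewrite -sc; case/and3P: xw.
have [z [zc wz wzy]] := IH yc.
have [xzy xwz] := between_transr xwy wzy.
exists z; split=> //; apply: (geo_cons (s := s)) nxw xw wz xwz.
by rewrite !inE sc.
Qed.

(** The witness [z] is the end of the last step along [c]. That step is nondegenerate and leads away
    from [a], so [c] runs from [a] to [z] in the same orientation. *)
Lemma geo_skip c S a x v : a \in L c.1 -> geo S x v -> between a x v ->
  geo (S :\ c) x v \/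
  exists z, [/\ seg c a z, geo (S :\ c) z v & between a z v].
Proof.
move=> ac; elim=> {x v} [x|s x y v sS nxy xy _ IH xyv] axv.
  by left; apply: geo_nil.
have [ayv axy] := between_transr axv xyv.
case: (IH ayv) => [yv|]; last by right.
have [sc|sc] := eqVneq s c; last first.
  by left; apply: (geo_cons (s := s)) nxy xy yv xyv; rewrite !inE sc.
by right; exists y; split=> //; apply: (seg_prefix ac nxy _ axy); rewrite -sc.
Qed.

Lemma geo_head c S a v : a \in L c.1 -> geo S a v ->
  exists z, [/\ seg c a z, geo (S :\ c) z v & between a z v].
Proof.
move=> ac av; have aav : between a a v by rewrite /between dxx.
case: (geo_skip ac av aav) => // av'; exists a; split=> //.
by rewrite /seg ac /=; case: c.2.
Qed.

(** * Minimal sets of oriented paths *)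

Definition min_geo a v S := minset (fun T => `[< geo T a v >]) S.

Lemma min_geoP a v S :
  min_geo a v S <-> geo S a v /\ forall T, geo T a v -> T \subset S -> T = S.
Proof.
split=> [/minsetP[/asboolP av min_av]|[av min_av]].
  by split=> // T Tav; apply: min_av; apply/asboolP.
by apply/minsetP; split; [apply/asboolP | move=> T /asboolP; apply: min_av].
Qed.

(** A smaller set leading from [z] to [v] would, with [c] added, contradict minimality for [a] and
    [v]. *)
Lemma min_geo_tail c (S : {set I * bool}) a z v :
  c \in S -> min_geo a v S -> seg c a z ->
  geo (S :\ c) z v -> between a z v -> min_geo z v (S :\ c).
Proof.
move=> cS /min_geoP[_ min_av] az zv azv; apply/min_geoP; split=> // T Tzv TS.
have cT : c \notin T.
  by apply/negP => /(subsetP TS); rewrite !inE eqxx.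
rewrite -(min_av (c |: T)) ?setU1K //.
  by apply: geo_seg az (geo_sub (subsetUr _ _) Tzv) azv; rewrite !inE eqxx.
by rewrite subUset sub1set cS (subset_trans TS) ?subsetDl.
Qed.

Lemma min_geo_inj S a v w :
  min_geo a v S -> min_geo a w S -> d a v = d a w -> v = w.
Proof.
have [n] := ubnP #|S|; elim: n => // n IHn in S a v w *.
move=> leSn av aw dvw; have [gav _] := (min_geoP _ _ _).1 av.
have [avE|[c cS ac]] := geo_start gav.
  by rewrite -avE; apply: d_eq0; rewrite -dvw -avE dxx.
(* By symmetry [v] is taken to leave [c] no later than [w]. *)
wlog: v w av aw dvw gav / exists z z',
    [/\ seg c a z, geo (S :\ c) z v & between a z v] /\
    [/\ seg c a z', geo (S :\ c) z' w & between a z' w] /\ d a z <= d a z'.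
  have [gaw _] := (min_geoP _ _ _).1 aw => wlog_zz.
  have [z zP] := geo_head ac gav; have [z' z'P] := geo_head ac gaw.
  have [le_zz|/ltnW le_zz] := leqP (d a z) (d a z').
    by apply: wlog_zz => //; exists z, z'.
  by apply/esym; apply: wlog_zz => //; exists z', z.
move=> [z [z' [[az zv azv] [[az' z'w az'w] le_zz]]]].
have azz := seg_between az az' le_zz.
have [azw zz'w] := between_trans az'w azz.
(* If [w] leaves [c] later than [z], then [v] leaves [z] by some [s]; as [w] also
   uses [s], following [s] from [z] is a shortcut for it that avoids [c]. *)
have zw : geo (S :\ c) z w.
  have [->//|nzz] := eqVneq z z'.
  have [zvE|[s sS zs]] := geo_start zv.
    (* If [z = v], then [d a v = d a z <= d a z' <= d a w = d a v], so nothing separates [z] from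
       [z']. *)
    case/eqP: nzz; apply: d_eq0; move: dvw azz az'w; rewrite -zvE /between; lia.
  have [z'w'|[z2 [zz2 z2w bz]]] := geo_skip zs z'w zz'w; last first.
    by apply: geo_seg sS zz2 _ bz; apply: geo_sub z2w; apply: subsetDl.
  (* Were [s] avoided from [z'] on, [c] followed by that geodesic would reach [w] without [s],
     against the minimality of [S]. *)
  have [_ min_aw] := (min_geoP _ _ _).1 aw.
  move: (sS); rewrite !inE => /andP[sc sS'].
  suff /min_aw/(_ (subsetDl _ _)) SsE : geo (S :\ s) a w.
    by move: sS'; rewrite -SsE !inE eqxx.
  apply: (geo_seg (s := c)) az' (geo_sub _ z'w') az'w.
    by rewrite !inE eq_sym sc.
  by rewrite setSD ?subsetDl.
have dzvw : d z v = d z w by move: azv azw dvw; rewrite /between; lia.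
apply: (IHn (S :\ c) z) => //; last 2 first.
- exact: min_geo_tail cS av az zv azv.
- exact: min_geo_tail cS aw az zw azw.
by move: leSn; rewrite (cardsD1 c) cS.
Qed.

(** * Coding of minimal sets by partial sign functions *)

Definition signed_set (f : {ffun I -> option bool}) : {set I * bool} :=
  [set s | f s.1 == Some s.2].

Lemma geo_extend f c a u v : geo (signed_set f) a u -> u \in L c ->
  v \in L c -> between a u v -> exists g, geo (signed_set g) a v.
Proof.
move=> au uc vc auv; have [y [yc ay ayu]] := geo_first_on au uc.
have [ayv _] := between_trans auv ayu.
have [b yv] := seg_total yc vc.
pose g := [ffun i => if i == c then Some b else f i].
exists g; apply: (geo_trans _ _ ayv).
  apply: geo_sub ay; apply/subsetP => s; rewrite !inE ffunE.
  by case: eqP.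
apply: (geo_seg _ yv (geo_nil _ _)); last by rewrite /between dxx addn0.
by rewrite inE ffunE /= eqxx.
Qed.

Lemma min_geo_exists f a v : geo (signed_set f) a v ->
  exists g, min_geo a v (signed_set g).
Proof.
move=> /asboolP /(minset_exists (P := fun T => `[< geo T a v >])).
move=> [S minS Sf].
(* Any subset of a signed set is signed: [g] is [f] restricted to the pairs kept in [S]. *)
pose g := [ffun i => if f i is Some b then
  if (i, b) \in S then Some b else None else None].
exists g; suff -> : signed_set g = S by [].
apply/finset.setP => -[i b]; rewrite inE ffunE /=.
have [bS|nbS] := boolP ((i, b) \in S).
  by have := subsetP Sf _ bS; rewrite inE /= => /eqP ->; rewrite bS eqxx.
case: (f i) => // b'; case: ifP => // b'S.
by apply/eqP => -[bb]; case/negP: nbS; rewrite -bb.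
Qed.

Lemma card_sphere a (A : {set V}) D :
  (forall v, v \in A -> d a v = D) ->
  (forall v, v \in A -> exists f, geo (signed_set f) a v) -> #|A| <= 3 ^ #|I|.
Proof.
move=> AD Ageo.
have code v : exists f, v \in A -> min_geo a v (signed_set f).
  have [vA|_] := boolP (v \in A); last by exists [ffun=> None].
  by have [f /min_geo_exists[g ming]] := Ageo v vA; exists g.
have /boolp.choice [g gP] := code.
suff injg : {in A &, injective g}.
  rewrite -(card_in_imset injg) (leq_trans (max_card _)) //.
  by rewrite card_ffun card_option card_bool.
move=> v w vA wA gvw; apply: (@min_geo_inj (signed_set (g v)) a).
- exact: gP.
- by rewrite gvw; apply: gP.
- by rewrite !AD.
Qed.

End Geodesics.

Lemma mem_zip (S T : eqType) (s : seq S) (t : seq T) x y :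
  (x, y) \in zip s t -> x \in s /\ y \in t.
Proof.
elim: s t => [|a s IHs] [|b t] //=; rewrite !inE.
case/orP=> [/eqP[-> ->]|/IHs[-> ->]].
  by rewrite !eqxx.
by rewrite !orbT.
Qed.

Lemma mem_bigcup_seq (I : eqType) (T : finType) (r : seq I)
    (F : I -> {set T}) x :
  x \in \bigcup_(i <- r) F i -> exists2 i, i \in r & x \in F i.
Proof.
rewrite big_seq; elim/big_rec: _ => [|i A ri IHA]; rewrite inE //.
by case/orP=> [|/IHA //]; exists i.
Qed.

(** * Metric properties of the graph distance *)

Section Distance.
Variables (V : finType) (e : rel V).
Hypothesis e_sym : symmetric e.

Lemma dist_path x p : path e x p -> dist e x (last x p) <= size p.
Proof.
case/shortenP => q eq uq qp.
have /dist_le/leq_trans -> // : path_between e x (last x q) q.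
  by rewrite /path_between eq uq eqxx.
by apply: uniq_leq_size => //; case/andP: uq.
Qed.

Lemma dist_max x y : dist e x y <= #|V|.
Proof. by rewrite -[X in _ <= X](size_iota 0) find_size. Qed.

Lemma dist_realized x y : dist e x y < #|V| ->
  exists p, [/\ path e x p, last x p = y & size p = dist e x y].
Proof.
move=> ltd; have := ltd.
rewrite /dist -[X in _ < X](size_iota 0) -has_find => /(nth_find 0).
rewrite nth_iota // add0n => /existsP[p /and3P[ep _ /eqP px]].
by exists p; rewrite size_tuple.
Qed.

Lemma dist_refl x : dist e x x = 0.
Proof. by apply/eqP; rewrite -leqn0 (@dist_path x [::]). Qed.

Lemma dist_eq0 x y : dist e x y = 0 -> x = y.
Proof.
move=> d0; have [|p [_ px]] := @dist_realized x y.
  by rewrite d0; apply/card_gt0P; exists x.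
by rewrite d0 -px => /size0nil ->.
Qed.

(** The default [#|V|] for unreachable pairs bounds all distances, so the inequality survives when a
    term on the right takes it. *)
Lemma dist_triangle x y z : dist e x z <= dist e x y + dist e y z.
Proof.
have [/dist_realized[p [ep <- <-]]|le1] := ltnP (dist e x y) #|V|; last first.
  by rewrite (leq_trans (dist_max _ _)) // (leq_trans le1) ?leq_addr.
have [/dist_realized[q [eq <- <-]]|le2] := ltnP (dist e (last x p) z) #|V|.
  by rewrite -size_cat -last_cat dist_path // cat_path ep.
by rewrite (leq_trans (dist_max _ _)) // (leq_trans le2) ?leq_addl.
Qed.

Lemma dist_sym x y : dist e x y = dist e y x.
Proof.
suff le_d u v : dist e u v <= dist e v u by apply/eqP; rewrite eqn_leq !le_d.
have [/dist_realized[p [ep <- <-]]|le1] := ltnP (dist e v u) #|V|; last first.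
  exact: leq_trans (dist_max _ _) le1.
have rp : path e (last v p) (rev (belast v p)).
  by rewrite rev_path (eq_path (e' := e)) // => a b; apply: e_sym.
have := dist_path rp; rewrite size_rev size_belast.
by case: (p) => [|a q] //=; rewrite rev_cons last_rcons.
Qed.

Lemma dist_edge x y : e x y -> dist e x y <= 1.
Proof. by move=> exy; apply: (@dist_path x [:: y]); rewrite /= exy. Qed.

(** Each subpath bounds the distance of its ends from above; since the whole path attains its
    length, the triangle inequality forces equality throughout. *)
Lemma shortest_path_isometric (P : V * seq V) x y : shortest_path e P ->
  x \in P.1 :: P.2 -> y \in P.1 :: P.2 ->
  dist e x y = (index x (P.1 :: P.2) - index y (P.1 :: P.2))
             + (index y (P.1 :: P.2) - index x (P.1 :: P.2)).
Proof.
case: P => a p /= /andP[/and3P[/= ep up _] /eqP szp].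
have sub i j : i <= j -> j <= size p ->
    dist e (nth a (a :: p) i) (nth a (a :: p) j) <= j - i.
  elim: j => [|j IHj]; first by rewrite leqn0 => /eqP ->; rewrite dist_refl.
  rewrite leq_eqVlt ltnS => /orP[/eqP -> _|ij jp].
    by rewrite dist_refl.
  rewrite subSn // -[leqRHS]addn1.
  apply: leq_trans (dist_triangle _ (nth a (a :: p) j) _) _.
  apply: leq_add; first exact: IHj ij (ltnW jp).
  exact/dist_edge/(pathP a ep).
have iso i j : i <= j -> j <= size p ->
    dist e (nth a (a :: p) i) (nth a (a :: p) j) = j - i.
  move=> ij jp; apply/eqP; rewrite eqn_leq sub //=.
  have := sub 0 i isT (leq_trans ij jp).
  have := sub j (size p) jp (leqnn _).
  have := dist_triangle a (nth a (a :: p) i) (last a p).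
  have := dist_triangle (nth a (a :: p) i) (nth a (a :: p) j) (last a p).
  rewrite -szp [nth a _ (size p)]nth_last /=; lia.
wlog le_xy : x y / index x (a :: p) <= index y (a :: p) => [wl xp yp|xp yp].
  have [/wl->//|/ltnW/wl yx] := leqP (index x (a :: p)) (index y (a :: p)).
  by rewrite dist_sym yx // addnC.
move: (yp); rewrite -index_mem ltnS => /(iso _ _ le_xy).
by rewrite !nth_index // => ->; move: le_xy => /=; lia.
Qed.

Lemma path_edges_vertices (P : V * seq V) x y :
  [set x; y] \in path_edges P -> (x \in P.1 :: P.2) && (y \in P.1 :: P.2).
Proof.
rewrite inE => /mapP[[u v] /= /mem_zip[uP vP] xyE].
have : (x \in [set u; v]) && (y \in [set u; v]) by rewrite -xyE !inE !eqxx orbT.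
have vP' : v \in P.1 :: P.2 by rewrite inE vP orbT.
by rewrite !in_set2 => /andP[/orP[] /eqP -> /orP[] /eqP ->]; rewrite ?uP ?vP'.
Qed.

End Distance.

(** * Path decompositions from layerings *)

Section Layers.
Variables (V : finType) (e : rel V).
Hypothesis e_sym : symmetric e.

Lemma connect_dist x y : connect e x y -> dist e x y < #|V|.
Proof.
case/connectP=> p /shortenP[q eq uq _] ->.
have /dist_le/leq_ltn_trans -> // : path_between e x (last x q) q.
  by rewrite /path_between eq uq eqxx.
by rewrite -[(size q).+1]/(size (x :: q)) -(card_uniqP uq) max_card.
Qed.

Lemma layers_pathwidth_le (l : V -> nat) m :
  (forall x y, e x y -> l x <= (l y).+1) ->
  (forall D, #|[set v | l v == D]| <= m) ->
  (pathwidth e <= (2 * m)%N%:Z)%R.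
Proof.
move=> l_lip l_card; pose N := (\max_v l v).+1.
have ltN v : l v < N by rewrite ltnS leq_bigmax.
(* Bag [i] is the union of layers [i] and [i.+1]; as [0.-1 = 0], layer [0] occurs in bag [0]
   only. *)
pose X := mkseq (fun i => [set v | (l v).-1 <= i <= l v]) N.
have Xnth i : i < N -> nth set0 X i = [set v | (l v).-1 <= i <= l v].
  by move=> iN; rewrite nth_mkseq.
have pdX : path_decomposition e X.
  split=> [x y exy|x].
    have lxy := l_lip _ _ exy; have lyx : l y <= (l x).+1.
      by apply: l_lip; rewrite e_sym.
    exists (nth set0 X (minn (l x) (l y))).
      by rewrite mem_nth // size_mkseq gtn_min ltN.
    by rewrite Xnth ?gtn_min ?ltN // !inE; lia.
  exists (l x).-1, (l x); rewrite leq_pred size_mkseq; split=> // i iN.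
  by rewrite Xnth // inE.
apply: Order.POrderTheory.le_trans (pathwidth_le pdX) _; rewrite /width.
suff : \max_(B <- X) #|B| <= 2 * m by lia.
apply/bigmax_leqP_seq => B /mapP[i _ ->] _.
rewrite mul2n -addnn (leq_trans _ (leq_add (l_card i) (l_card i.+1))) //.
rewrite (leq_trans _ (leq_card_setU _ _).1) // subset_leq_card //.
by apply/subsetP => v; rewrite !inE; lia.
Qed.

End Layers.

(** Requiring [connect e a v] keeps unreachable vertices, all at the default distance, out of the
    sphere of radius [#|V|]. *)
Lemma card_sphere_le (V : finType) (e : rel V) (Ps : seq (V * seq V)) a D :
  symmetric e -> all (shortest_path e) Ps ->
  edge_set e = \bigcup_(P <- Ps) path_edges P ->
  #|[set v | connect e a v & dist e a v == D]| <= 3 ^ size Ps.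
Proof.
move=> e_sym sP cover.
pose P_ (c : 'I_(size Ps)) := tnth (in_tuple Ps) c.
have sP_ c : shortest_path e (P_ c) by apply: (allP sP); apply: mem_tnth.
pose L c := [pred x | x \in (P_ c).1 :: (P_ c).2].
pose pos c x := index x ((P_ c).1 :: (P_ c).2).
have d_pos c x y : x \in L c -> y \in L c ->
    dist e x y = (pos c x - pos c y) + (pos c y - pos c x).
  exact: shortest_path_isometric.
have edge_path x y : e x y -> exists c, (x \in L c) && (y \in L c).
  move=> exy; have : [set x; y] \in edge_set e.
    by apply/imsetP; exists (x, y); rewrite ?inE.
  rewrite cover => /mem_bigcup_seq[P PPs /path_edges_vertices xyP].
  have /tnthP[c Pc] : P \in in_tuple Ps by [].
  by exists c; move: xyP; rewrite Pc.
have d_triangle := @dist_triangle _ e.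
(* Induction along a shortest path: its last edge lies on some path of [Ps], and [geo_extend]
   absorbs it. *)
have geoE n v : connect e a v -> dist e a v = n ->
    exists f, geo (dist e) L pos (signed_set f) a v.
  elim: n v => [|n IHn] v av dn.
    by exists [ffun=> None]; rewrite (dist_eq0 dn); apply: geo_nil.
  have [p [ep pv szp]] := dist_realized (connect_dist av).
  case/lastP: p => [|p w] in ep pv szp; first by rewrite dn in szp.
  move: ep pv szp; rewrite last_rcons rcons_path size_rcons dn.
  case/andP=> ep euw wv [szp]; rewrite wv {w wv} in euw.
  set u := last a p in euw.
  have au : dist e a u <= n by rewrite -szp dist_path.
  have uv := dist_edge euw; have auv := d_triangle a u v.
  have dau : dist e a u = n by lia.
  have conn_u : connect e a u by apply/connectP; exists p.
  have [f gf] := IHn u conn_u dau.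
  have [c /andP[uc vc]] := edge_path _ _ euw.
  apply: (geo_extend (@dist_refl _ e) d_triangle gf uc vc).
  rewrite /between; lia.
rewrite -[size Ps]card_ord.
apply: (card_sphere (@dist_refl _ e) (@dist_eq0 _ e) d_triangle d_pos
  (a := a) (D := D)).
  by move=> v; rewrite inE => /andP[_ /eqP].
by move=> v; rewrite inE => /andP[av _]; apply: geoE av _.
Qed.

Theorem theorem1 :
  exists C : nat, 0 < C /\
    forall (k : nat) (V : finType) (e : rel V) (Ps : seq (V * seq V)),
      1 <= k ->
      symmetric e -> irreflexive e ->
      size Ps <= k ->
      all (shortest_path e) Ps ->
      edge_set e = \bigcup_(P <- Ps) path_edges P ->
      (pathwidth e <= (C * 3 ^ k)%N%:Z)%R.
Proof.
(* The constant counts the two layers in each bag. *)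
exists 2; split=> // k V e Ps _ e_sym _ szP sP cover.
have e_csym := sym_connect_sym e_sym.
pose r x := fingraph.root e x.
(* The components occupy disjoint ranges of layers, since [dist <= #|V|]. *)
pose l x := enum_rank (r x) * #|V|.+1 + dist e (r x) x.
apply: (@layers_pathwidth_le _ _ e_sym l) => // [x y exy|D].
  have -> : l x = enum_rank (r y) * #|V|.+1 + dist e (r y) x.
    by rewrite /l /r (fingraph.rootP e_csym (connect1 exy)).
  rewrite -addnS leq_add2l (leq_trans (dist_triangle _ _ y _)) //.
  rewrite -addn1 leq_add2l.
  by rewrite dist_edge // e_sym.
have [->|[a]] := set_0Vmem [set v | l v == D]; first by rewrite cards0.
rewrite inE => /eqP laD.
apply: leq_trans (leq_pexp2l _ szP) => //.
apply: leq_trans (card_sphere_le (r a) (dist e (r a) a) e_sym sP cover).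
apply/subset_leq_card/subsetP => v; rewrite !inE -laD => /eqP lva.
(* Quotient and remainder recover the component and the distance to its root, so a nonempty layer is
   a single sphere. *)
have divl x : l x %/ #|V|.+1 = enum_rank (r x).
  by rewrite divnMDl // divn_small ?addn0 // ltnS dist_max.
have modl x : l x %% #|V|.+1 = dist e (r x) x.
  by rewrite modnMDl modn_small // ltnS dist_max.
have rva : r v = r a.
  by apply/enum_rank_inj/val_inj; rewrite /= -!divl lva.
have := modl v; rewrite lva modl rva => ->.
by rewrite eqxx andbT -rva e_csym connect_root.
Qed.
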